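(* Let $B$ be a unital $\mathbb K$-algebra. The maps $\lambda(f)=I\cdot f$ and $\rho(f)=f\cdot I$ on $\mathfrak g_B^{\mathrm{inv}}$ are Nijenhuis maps for the pre-Lie algebra $(\mathfrak g_B^{\mathrm{inv}},\{\cdot,\cdot\})$, i.e. for all $f,g\in\mathfrak g_B^{\mathrm{inv}}$, $$\{\lambda(f),\lambda(g)\}=\lambda\big(\{\lambda(f),g\}+\{f,\lambda(g)\}-\lambda(\{f,g\})\big),$$ and similarly with $\lambda$ replaced by $\rho$.
   Context: $\mathbb K$ is a field of characteristic zero. For a unital $\mathbb K$-algebra $B$, $\mathrm{Mult}[[B]]$ is the $\mathbb K$-vector space of sequences $f=(f_n)_{n\ge0}$ of $\mathbb K$-multilinear maps $f_n:B^{\otimes n}\to B$ (with $B^{\otimes 0}=\mathbb K$, so $f_0$ is identified with an element of $B$), with product $(f\cdot g)_n(x_1,\dots,x_n)=\sum_{k=0}^n f_k(x_1,\dots,x_k)\,g_{n-k}(x_{k+1},\dots,x_n)$. $I:=(\delta_{n,1}\mathrm{Id})_{n\ge0}$, and $\mathfrak g_B^{\mathrm{inv}}:=\{f\in\mathrm{Mult}[[B]]: f_0=0\}$. For $f,g\in\mathfrak g_B^{\mathrm{inv}}$, $\{f,g\}\in\mathfrak g_B^{\mathrm{inv}}$ is the series with, for $N\ge1$, $$\{f,g\}_N(x_1,\dots,x_N)=\sum_{\substack{n,m\ge1\\ n+m=N+1}}\ \sum_{i=1}^n f_n\big(x_1,\dots,x_{i-1},g_m(x_i,\dots,x_{i+m-1}),x_{i+m},\dots,x_N\big);$$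 this is a right pre-Lie product on $\mathfrak g_B^{\mathrm{inv}}$. *)

(* Defs.v *)
From HB Require Import structures.
From mathcomp Require Import all_boot all_algebra boolp.
Set Implicit Arguments.
Unset Strict Implicit.
Unset Printing Implicit Defensive.
Import GRing.Theory.
Local Open Scope ring_scope.

HB.mixin Record isRightPreLie (K : comPzRingType) V of GRing.Lmodule K V := {
  prelie : V -> V -> V;
  prelie_linearl : forall y : V, linear (prelie ^~ y);
  prelie_linearr : forall x : V, linear (prelie x);
  prelieP : forall x y z : V,
    prelie (prelie x y) z - prelie x (prelie y z)
    = prelie (prelie x z) y - prelie x (prelie z y)
}.

#[short(type="rightPreLieType")]
HB.structure Definition RightPreLie (K : comPzRingType) :=
  {V of GRing.Lmodule K V & isRightPreLie K V}.

Definition nijenhuis (K : comPzRingType) (V : rightPreLieType K)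
    (P : {linear V -> V}) : Prop :=
  forall x y : V,
    prelie (P x) (P y)
    = P (prelie (P x) y + prelie x (P y) - P (prelie x y)).

Definition multilinear (K : fieldType) (B : algType K) (n : nat)
    (phi : n.-tuple B -> B) : Prop :=
  forall (i : 'I_n) (x : n.-tuple B),
    linear (fun y : B => phi [tuple if j == i then y else tnth x j | j < n]).

(* Mult[[B]]. A multilinear map B^{\otimes n} -> B is a multilinear function
   of n arguments; the degree 0 part is determined by its value at [tuple]. *)
Record Mult (K : fieldType) (B : algType K) := MkMult {
  coef :> forall n : nat, n.-tuple B -> B;
  coef_multilinear : forall n : nat, multilinear (@coef n)
}.
Arguments coef {K B} f n x : rename.

(* evm f [:: x_1; ...; x_n] is f_n (x_1, ..., x_n). *)
Definition evm (K : fieldType) (B : algType K) (f : Mult B) (s : seq B) : B :=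
  f (size s) (in_tuple s).

Section Evaluation.
Variables (K : fieldType) (B : algType K).
Implicit Types (f g h : Mult B) (s x p q r : seq B).

Lemma evm_tuple f n (x : n.-tuple B) : evm f x = f n x.
Proof.
case: x => x xn; rewrite /evm /=; move: (xn); rewrite -(eqP xn) => xn'.
by congr (f _ _); apply: val_inj.
Qed.

Lemma mult_ext f g : (forall x, evm f x = evm g x) -> f = g.
Proof.
case: f g => [f fP] [g gP] fg.
have E : f = g.
  apply: functional_extensionality_dep => n.
  apply: functional_extensionality_dep => x.
  by have := fg x; rewrite !evm_tuple.
by case: _ / E gP {fg} => gP; congr MkMult; apply: Prop_irrelevance.
Qed.

Definition seq_multilinear (F : seq B -> B) : Prop :=
  forall p q, linear (fun y : B => F (p ++ y :: q)).

Lemma seq_multilinearP (F : seq B -> B) :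
  seq_multilinear F ->
  forall n, multilinear (fun x : n.-tuple B => F x).
Proof.
move=> FP n i x a u v.
have E (y : B) : [tuple if j == i then y else tnth x j | j < n]
    = take i x ++ y :: drop i.+1 x :> seq B.
  have ix : (i < size x)%N by rewrite size_tuple.
  have sz : size (take i x ++ y :: drop i.+1 x) = n.
    by rewrite size_cat /= size_take ix size_drop size_tuple subnSK // subnKC // ltnW.
  apply: (@eq_from_nth _ 0); first by rewrite sz size_tuple.
  rewrite size_tuple => k kn.
  rewrite -[LHS]/(nth 0 _ (Ordinal kn)) -tnth_nth tnth_mktuple.
  rewrite nth_cat size_take ix -val_eqE /=.
  case: (ltngtP k i) => [ki|ik|->].
  - by rewrite nth_take // (tnth_nth 0).
  - by rewrite (tnth_nth 0) /= -(subnSK ik) /= nth_drop subnKC.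
  - by rewrite subnn.
by rewrite !E FP.
Qed.

Lemma evm_multilinear f : seq_multilinear (evm f).
Proof.
move=> p q a u v.
set n := (size p + (size q).+1)%N.
have pn : (size p < n)%N by rewrite /n addnS ltnS leq_addr.
have sz y : size (p ++ y :: q) == n by rewrite size_cat.
pose t y := Tuple (sz y).
have E y : t y = [tuple if j == Ordinal pn then y else tnth (t 0) j | j < n].
  apply: eq_from_tnth => j; rewrite tnth_mktuple !(tnth_nth 0) /= -val_eqE /=.
  rewrite !nth_cat; case: ltngtP => [//|ij|->]; last by rewrite subnn.
  by rewrite -(subnSK ij).
have F y : evm f (p ++ y :: q) = f n (t y) by rewrite -evm_tuple.
by rewrite !F (E (a *: u + v)) coef_multilinear -!E.
Qed.

Lemma seq_multilinear0 (F : seq B -> B) p q :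
  seq_multilinear F -> F (p ++ 0 :: q) = 0.
Proof.
by move=> FP; have := FP p q (-1) 0 0; rewrite scaleN1r oppr0 addr0 scaleN1r addNr.
Qed.

(* The sum of F p q over all p, q with p ++ q = x. *)
Fixpoint dec (F : seq B -> seq B -> B) (x : seq B) : B :=
  if x is a :: x' then F [::] x + dec (fun p => F (a :: p)) x' else F [::] [::].

Lemma eq_dec F G x : (forall p q, F p q = G p q) -> dec F x = dec G x.
Proof.
elim: x F G => [|a x IH] F G FG /=; first exact: FG.
by rewrite FG; congr (_ + _); apply: IH => p q; apply: FG.
Qed.

Lemma decD F G x : dec (fun p q => F p q + G p q) x = dec F x + dec G x.
Proof.
elim: x F G => [//|a x IH] F G /=.
by rewrite (IH (fun p => F (a :: p)) (fun p => G (a :: p))) addrACA.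
Qed.

Lemma decZ c F x : dec (fun p q => c *: F p q) x = c *: dec F x.
Proof.
by elim: x F => [//|a x IH] F /=; rewrite (IH (fun p => F (a :: p))) scalerDr.
Qed.

Lemma decE F x : dec F x = \sum_(0 <= k < (size x).+1) F (take k x) (drop k x).
Proof.
elim: x F => [|a x IH] F; first by rewrite big_nat1.
by rewrite big_nat_recl //= IH.
Qed.

Lemma dec_coassoc (F : seq B -> seq B -> seq B -> B) x :
  dec (fun p r => dec (F p) r) x = dec (fun r s => dec (fun p q => F p q s) r) x.
Proof.
elim: x F => [//|a x IH] F /=; rewrite (IH (fun p => F (a :: p))).
rewrite -addrA; congr (_ + _).
by rewrite -decD.
Qed.

Lemma dec_cat F p y q :
  dec F (p ++ y :: q)
  = dec (fun a b => F a (b ++ y :: q)) p + dec (fun a b => F (p ++ y :: a) b) q.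
Proof.
elim: p F => [//|a p IH] F /=.
by rewrite (IH (fun p => F (a :: p))) addrA.
Qed.

Lemma dec_multilinear (F : seq B -> B) G p q x :
  seq_multilinear F ->
  F (p ++ dec G x :: q) = dec (fun a b => F (p ++ G a b :: q)) x.
Proof.
move=> FP; elim: x G => [//|a x IH] G /=.
have := FP p q 1 (G [::] (a :: x)) (dec (fun b => G (a :: b)) x).
by rewrite !scale1r => ->; rewrite (IH (fun b => G (a :: b))).
Qed.

Lemma dec_exchange (F : seq B -> seq B -> seq B -> seq B -> B) x y :
  dec (fun a b => dec (F a b) y) x
  = dec (fun c d => dec (fun a b => F a b c d) x) y.
Proof.
rewrite !decE; transitivity (\sum_(0 <= k < (size x).+1)
  \sum_(0 <= l < (size y).+1) F (take k x) (drop k x) (take l y) (drop l y)).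
  by apply: eq_bigr => k _; rewrite decE.
by rewrite exchange_big; apply: eq_bigr => l _; rewrite decE.
Qed.

End Evaluation.

Section Multilinear.
Variables (K : fieldType) (B : algType K).

Fact mzero_multilinear n : multilinear (fun _ : n.-tuple B => 0 : B).
Proof. by move=> i x a u v; rewrite scaler0 addr0. Qed.

Definition mzero : Mult B := MkMult mzero_multilinear.

Fact mopp_multilinear (f : Mult B) n :
  multilinear (fun x : n.-tuple B => - f n x).
Proof. by move=> i x a u v; rewrite coef_multilinear opprD scalerN. Qed.

Definition mopp (f : Mult B) : Mult B := MkMult (mopp_multilinear f).

Fact madd_multilinear (f g : Mult B) n :
  multilinear (fun x : n.-tuple B => f n x + g n x).
Proof. by move=> i x a u v; rewrite !coef_multilinear scalerDr addrACA. Qed.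

Definition madd (f g : Mult B) : Mult B := MkMult (madd_multilinear f g).

Fact mscale_multilinear (c : K) (f : Mult B) n :
  multilinear (fun x : n.-tuple B => c *: f n x).
Proof.
by move=> i x a u v; rewrite coef_multilinear scalerDr !scalerA mulrC.
Qed.

Definition mscale (c : K) (f : Mult B) : Mult B := MkMult (mscale_multilinear c f).

HB.instance Definition _ := gen_eqMixin (Mult B).
HB.instance Definition _ := gen_choiceMixin (Mult B).

Fact maddA : associative madd.
Proof. by move=> f g h; apply: mult_ext => x; apply: addrA. Qed.
Fact maddC : commutative madd.
Proof. by move=> f g; apply: mult_ext => x; apply: addrC. Qed.
Fact madd0 : left_id mzero madd.
Proof. by move=> f; apply: mult_ext => x; apply: add0r. Qed.
Fact maddN : left_inverse mzero mopp madd.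
Proof. by move=> f; apply: mult_ext => x; apply: addNr. Qed.

HB.instance Definition _ := GRing.isZmodule.Build (Mult B) maddA maddC madd0 maddN.

Fact mscaleA c d f : mscale c (mscale d f) = mscale (c * d) f.
Proof. by apply: mult_ext => x; apply: scalerA. Qed.
Fact mscale1 : left_id 1 mscale.
Proof. by move=> f; apply: mult_ext => x; apply: scale1r. Qed.
Fact mscaleDr : right_distributive mscale +%R.
Proof. by move=> c f g; apply: mult_ext => x; apply: scalerDr. Qed.
Fact mscaleDl f : {morph mscale^~ f : c d / c + d}.
Proof. by move=> c d; apply: mult_ext => x; apply: scalerDl. Qed.

HB.instance Definition _ :=
  GRing.Zmodule_isLmodule.Build K (Mult B) mscaleA mscale1 mscaleDr mscaleDl.

Lemma coefD (f g : Mult B) n x : (f + g) n x = f n x + g n x. Proof. by []. Qed.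
Lemma coefN (f : Mult B) n x : (- f) n x = - f n x. Proof. by []. Qed.
Lemma coefZ c (f : Mult B) n x : (c *: f) n x = c *: f n x. Proof. by []. Qed.
Lemma evmD (f g : Mult B) x : evm (f + g) x = evm f x + evm g x.
Proof. by []. Qed.
Lemma evmN (f : Mult B) x : evm (- f) x = - evm f x. Proof. by []. Qed.
Lemma evmZ c (f : Mult B) x : evm (c *: f) x = c *: evm f x. Proof. by []. Qed.

Definition idm_coef (n : nat) : n.-tuple B -> B :=
  match n with 1 => fun x => thead x | _ => fun => 0 end.

Fact idm_multilinear n : multilinear (@idm_coef n).
Proof.
case: n => [|[|n]]; do ?exact: mzero_multilinear.
by move=> i x a u v; rewrite /= /thead !tnth_mktuple (ord1 i) eqxx.
Qed.

Definition idm : Mult B := MkMult idm_multilinear.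

Definition mmul_coef (f g : Mult B) (n : nat) (x : n.-tuple B) : B :=
  \sum_(0 <= k < n.+1) evm f (take k x) * evm g (drop k x).

Lemma mmul_coefE f g n (x : n.-tuple B) :
  mmul_coef f g x = dec (fun p q => evm f p * evm g q) x.
Proof. by rewrite decE size_tuple. Qed.

Fact mmul_multilinear f g n : multilinear (@mmul_coef f g n).
Proof.
rewrite (_ : @mmul_coef f g n
  = fun x => dec (fun p q => evm f p * evm g q) x); last first.
  by apply: functional_extensionality_dep => x; apply: mmul_coefE.
apply: seq_multilinearP => p q a u v; rewrite !dec_cat scalerDr addrACA.
rewrite -!decZ -!decD; congr (_ + _); apply: eq_dec => r s.
  by rewrite evm_multilinear mulrDr scalerAr.
by rewrite evm_multilinear mulrDl scalerAl.
Qed.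

Definition mmul (f g : Mult B) : Mult B := MkMult (@mmul_multilinear f g).

Lemma evm_mmul f g x : evm (mmul f g) x = dec (fun p q => evm f p * evm g q) x.
Proof. exact: mmul_coefE. Qed.

Lemma mmul0E f g : mmul f g 0 [tuple] = f 0 [tuple] * g 0 [tuple].
Proof. by rewrite /= /mmul_coef big_nat1 /= -!evm_tuple. Qed.

Fact mmul_linearl g : linear (mmul ^~ g).
Proof.
move=> c f f'; apply: mult_ext => x; rewrite evmD evmZ !evm_mmul -decZ -decD.
by apply: eq_dec => p q; rewrite evmD evmZ mulrDl scalerAl.
Qed.

Fact mmul_linearr f : linear (mmul f).
Proof.
move=> c g g'; apply: mult_ext => x; rewrite evmD evmZ !evm_mmul -decZ -decD.
by apply: eq_dec => p q; rewrite evmD evmZ mulrDr scalerAr.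
Qed.

End Multilinear.

Record ginv (K : fieldType) (B : algType K) := Ginv {
  ginv_val :> Mult B;
  ginv_coef0 : ginv_val 0 [tuple] == 0
}.

Section Ginv.
Variables (K : fieldType) (B : algType K).

HB.instance Definition _ := [isSub for @ginv_val K B].
HB.instance Definition _ := [Choice of ginv B by <:].

Fact ginv_submod_closed : submod_closed [pred f : Mult B | f 0 [tuple] == 0].
Proof.
split=> [|a f g]; rewrite ?inE // => /eqP f0 /eqP g0.
by change (a *: f 0 [tuple] + g 0 [tuple] == 0); rewrite f0 g0 scaler0 addr0.
Qed.

HB.instance Definition _ :=
  GRing.SubChoice_isSubLmodule.Build K (Mult B) _ (ginv B) ginv_submod_closed.

Lemma evm_ginv0 (f : ginv B) : evm f [::] = 0.
Proof. by rewrite (evm_tuple f [tuple]); apply/eqP/ginv_coef0. Qed.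

(* With i counted from 0, the summand is
   f_n (x_1, ..., x_i, g_m (x_{i+1}, ..., x_{i+m}), x_{i+m+1}, ..., x_N). *)
Definition br_coef (f g : Mult B) (N : nat) (x : N.-tuple B) : B :=
  \sum_(1 <= n < N.+1) \sum_(1 <= m < N.+1 | (n + m == N.+1)%N)
    \sum_(0 <= i < n)
      evm f (take i x ++ evm g (take m (drop i x)) :: drop (i + m) x).

Lemma br_coefE (f g : ginv B) N (x : N.-tuple B) :
  br_coef f g x
  = dec (fun p r => dec (fun q s => evm f (p ++ evm g q :: s)) r) x.
Proof.
pose G i m := evm f (take i x ++ evm g (take m (drop i x)) :: drop (i + m) x).
rewrite decE size_tuple.
transitivity (\sum_(1 <= m < N.+1)
    \sum_(0 <= i < N.+1 | (i < N.+1 - m)%N) G i m).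
  rewrite /br_coef (exchange_big_dep_nat xpredT) //=; apply: eq_big_nat.
  move=> m /andP[m0 mN]; transitivity (\sum_(0 <= i < N.+1 - m) G i m); last first.
    by apply: big_nat_widen; apply: leq_subr.
  have nP : (N.+1 - m)%N \in index_iota 1 N.+1.
    rewrite mem_index_iota subn_gt0 mN /= ltnS leq_subLR.
    by case: m m0 {mN} => // m _; rewrite addSn ltnS leq_addl.
  rewrite big_mkcond (bigD1_seq _ nP (iota_uniq _ _)) /= subnK; last exact: ltnW.
  rewrite eqxx -[RHS]addr0; congr (_ + _); apply: big1 => n nm.
  case: eqP => // nmN.
  by rewrite -nmN addnK eqxx in nm.
rewrite (exchange_big_dep_nat xpredT) //=; apply: eq_big_nat => i /andP[_ iN].
rewrite decE size_drop size_tuple big_nat_recl //= take0 evm_ginv0.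
rewrite (seq_multilinear0 _ _ (@evm_multilinear _ _ f)) add0r.
rewrite -(big_add1 _ _ 0 (N - i).+1 xpredT
  (fun m => evm f (take i x ++ evm g (take m (drop i x)) :: drop m (drop i x)))).
rewrite (@big_nat_widen _ _ _ 1 (N - i).+1 N.+1); last by rewrite ltnS leq_subr.
rewrite big_nat_cond [RHS]big_nat_cond; apply: eq_big => m.
  by congr (_ && _); rewrite /= -subSn // !ltn_subRL addnC.
by move=> _; rewrite /G drop_drop addnC.
Qed.

Fact br_multilinear (f g : ginv B) n : multilinear (@br_coef f g n).
Proof.
rewrite (_ : @br_coef f g n = fun x =>
    dec (fun p r => dec (fun q s => evm f (p ++ evm g q :: s)) r) x); last first.
  by apply: functional_extensionality_dep => x; apply: br_coefE.
apply: seq_multilinearP => p q a u v; rewrite !dec_cat scalerDr addrACA.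
rewrite -!decZ -!decD; congr (_ + _); apply: eq_dec => r s; last first.
  rewrite -decZ -decD; apply: eq_dec => t w.
  by rewrite -!catA !cat_cons evm_multilinear.
rewrite !dec_cat scalerDr addrACA -!decZ -!decD.
congr (_ + _); apply: eq_dec => t w.
  by rewrite -!cat_cons !catA evm_multilinear.
by rewrite !evm_multilinear.
Qed.

Fact br_coef0 (f g : ginv B) :
  MkMult (@br_multilinear f g) 0 [tuple] == 0.
Proof. by rewrite /= /br_coef big_geq. Qed.

Definition br (f g : ginv B) : ginv B := Ginv (br_coef0 f g).

Lemma evm_br (f g : ginv B) x :
  evm (br f g) x
  = dec (fun p r => dec (fun q s => evm f (p ++ evm g q :: s)) r) x.
Proof. exact: br_coefE. Qed.

Lemma ginv_ext (f g : ginv B) : (forall x, evm f x = evm g x) -> f = g.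
Proof. by move=> fg; apply/val_inj/mult_ext. Qed.

Lemma evm_ginvD (f g : ginv B) x : evm (f + g) x = evm f x + evm g x.
Proof. by []. Qed.
Lemma evm_ginvN (f : ginv B) x : evm (- f) x = - evm f x. Proof. by []. Qed.
Lemma evm_ginvZ c (f : ginv B) x : evm (c *: f) x = c *: evm f x.
Proof. by []. Qed.

Fact br_linearl (g : ginv B) : linear (br ^~ g).
Proof.
move=> c f f'; apply: ginv_ext => x; rewrite evm_ginvD evm_ginvZ !evm_br.
rewrite -decZ -decD; apply: eq_dec => p r.
by rewrite -decZ -decD; apply: eq_dec => q s; rewrite evm_ginvD evm_ginvZ.
Qed.

Fact br_linearr (f : ginv B) : linear (br f).
Proof.
move=> c g g'; apply: ginv_ext => x; rewrite evm_ginvD evm_ginvZ !evm_br.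
rewrite -decZ -decD; apply: eq_dec => p r.
rewrite -decZ -decD; apply: eq_dec => q s.
by rewrite evm_ginvD evm_ginvZ evm_multilinear.
Qed.

(* The right-hand side is the sum over all insertions of g and h into f at two
   disjoint places, which is symmetric in g and h. *)
Lemma br_assoc (f g h : ginv B) x :
  evm (br (br f g) h - br f (br g h)) x
  = dec (fun p r => dec (fun q s => dec (fun s1 s' => dec (fun s2 s3 =>
      evm f (p ++ evm h q :: s1 ++ evm g s2 :: s3)) s') s) r) x
  + dec (fun p r => dec (fun q s => dec (fun s1 s' => dec (fun s2 s3 =>
      evm f (p ++ evm g q :: s1 ++ evm h s2 :: s3)) s') s) r) x.
Proof.
rewrite evm_ginvD evm_ginvN !evm_br; apply/eqP; rewrite subr_eq; apply/eqP.
transitivity (dec (fun p r => dec (fun q s =>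
    dec (fun p1 p' => dec (fun p2 p3 =>
      evm f (p1 ++ evm g p2 :: p3 ++ evm h q :: s)) p') p
  + dec (fun p1 p2 => dec (fun s1 s2 =>
      evm f (p1 ++ evm g (p2 ++ evm h q :: s1) :: s2)) s) p
  + dec (fun s1 s' => dec (fun s2 s3 =>
      evm f (p ++ evm h q :: s1 ++ evm g s2 :: s3)) s') s) r) x).
  apply: eq_dec => p r; apply: eq_dec => q s; rewrite evm_br dec_cat.
  congr (_ + _); last first.
    apply: eq_dec => t w; apply: eq_dec => u v.
    by rewrite -catA cat_cons.
  rewrite -decD; apply: eq_dec => t w; exact: dec_cat.
have D (F G H : seq B -> seq B -> seq B -> B) :
    dec (fun p r => dec (fun q s => F p q s + G p q s + H p q s) r) x
    = dec (fun p r => dec (fun q s => H p q s) r) x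
      + dec (fun p r => dec (fun q s => F p q s) r) x
      + dec (fun p r => dec (fun q s => G p q s) r) x.
  rewrite -!decD; apply: eq_dec => p r; rewrite -!decD; apply: eq_dec => q s.
  by rewrite addrC addrA.
rewrite D; congr (_ + _ + _).
- pose E p1 p2 p3 q s := evm f (p1 ++ evm g p2 :: p3 ++ evm h q :: s).
  transitivity (dec (fun p r => dec (fun p1 p' => dec (fun p2 p3 =>
      dec (E p1 p2 p3) r) p') p) x).
    apply: eq_dec => p r; rewrite dec_exchange; apply: eq_dec => p1 p'.
    by rewrite dec_exchange.
  rewrite -(dec_coassoc (fun p1 p' r => dec (fun p2 p3 =>
      dec (E p1 p2 p3) r) p')).
  apply: eq_dec => p1 w.
  by rewrite -(dec_coassoc (fun p2 p3 r => dec (E p1 p2 p3) r)).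
- pose E p1 p2 q s1 s2 := evm f (p1 ++ evm g (p2 ++ evm h q :: s1) :: s2).
  transitivity (dec (fun p r => dec (fun p1 p2 => dec (fun q s =>
      dec (E p1 p2 q) s) r) p) x).
    by apply: eq_dec => p r; rewrite dec_exchange.
  rewrite -(dec_coassoc (fun p1 p2 r => dec (fun q s => dec (E p1 p2 q) s) r)).
  apply: eq_dec => p1 w.
  transitivity (dec (fun u s2 => dec (fun p2 v => dec (fun q s1 =>
      E p1 p2 q s1 s2) v) u) w); last first.
    apply: eq_dec => u s2; rewrite evm_br.
    rewrite (dec_multilinear _ _ _ _ (@evm_multilinear _ _ f)).
    apply: eq_dec => p2 v.
    by rewrite (dec_multilinear _ _ _ _ (@evm_multilinear _ _ f)).
  rewrite -(dec_coassoc (fun p2 v s2 => dec (fun q s1 => E p1 p2 q s1 s2) v)).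
  by apply: eq_dec => p2 v; rewrite -dec_coassoc.
Qed.

Fact brP (f g h : ginv B) :
  br (br f g) h - br f (br g h) = br (br f h) g - br f (br h g).
Proof. by apply: ginv_ext => x; rewrite !br_assoc addrC. Qed.

HB.instance Definition _ :=
  isRightPreLie.Build K (ginv B) br_linearl br_linearr brP.

Fact lam_coef0 (f : ginv B) : mmul (idm B) f 0 [tuple] == 0.
Proof. by rewrite mmul0E mul0r. Qed.

Definition lam (f : ginv B) : ginv B := Ginv (lam_coef0 f).

Fact rho_coef0 (f : ginv B) : mmul f (idm B) 0 [tuple] == 0.
Proof. by rewrite mmul0E mulr0. Qed.

Definition rho (f : ginv B) : ginv B := Ginv (rho_coef0 f).

Fact lam_linear : linear lam.
Proof. by move=> c f g; apply/val_inj/mmul_linearr. Qed.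

Fact rho_linear : linear rho.
Proof. by move=> c f g; apply/val_inj/mmul_linearl. Qed.

HB.instance Definition _ :=
  GRing.isLinear.Build K (ginv B) (ginv B) *:%R lam lam_linear.
HB.instance Definition _ :=
  GRing.isLinear.Build K (ginv B) (ginv B) *:%R rho rho_linear.

End Ginv.

(* Main.v *)
Require Import Defs.
From mathcomp Require Import all_boot all_algebra.
Import GRing.Theory.
Local Open Scope ring_scope.

(** Inserting [g] is a derivation of the product of series: in [f . h] the
    value of [g] enters either the factor [f] or the factor [h], so
    [{f . h, g} = {f, g} . h + f . {h, g}] ([br_gmul]). The identity series is
    a left unit of the bracket, [{I, g} = g] ([br_gidm]). Taking one factor to
    be [I] gives [{lam f, g} = g . f + lam {f, g}] and
    [{rho f, g} = f . g + rho {f, g}]. Hence, by associativity of the product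
    ([gmulA]),
    [{lam f, lam g} = lam g . f + lam {f, lam g} = lam (g . f + {f, lam g})],
    and [g . f] is exactly [{lam f, g} - lam {f, g}]. The same computation with
    [f . g] in place of [g . f] settles [rho]. *)

Section DecompositionSums.
Variables (K : fieldType) (B : algType K).
Implicit Types (F : seq B -> seq B -> B) (x : seq B).

Lemma dec_mulr c F x : c * dec F x = dec (fun p q => c * F p q) x.
Proof.
by elim: x F => [//|a x IH] F /=; rewrite mulrDr (IH (fun p => F (a :: p))).
Qed.

Lemma dec_mull c F x : dec F x * c = dec (fun p q => F p q * c) x.
Proof.
by elim: x F => [//|a x IH] F /=; rewrite mulrDl (IH (fun p => F (a :: p))).
Qed.

Lemma dec0 F x : (forall p q, F p q = 0) -> dec F x = 0.
Proof. by move=> F0; rewrite decE big1. Qed.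

Lemma dec_nill F x : (forall a p q, F (a :: p) q = 0) -> dec F x = F [::] x.
Proof. by case: x => [//|a x] F0 /=; rewrite dec0 ?addr0. Qed.

Lemma dec_nilr F x : (forall p a q, F p (a :: q) = 0) -> dec F x = F x [::].
Proof.
elim: x F => [//|a x IH] F F0 /=; rewrite F0 add0r.
by rewrite (IH (fun p => F (a :: p))) // => p; apply: F0.
Qed.

End DecompositionSums.

Section InvertibleSeries.
Variables (K : fieldType) (B : algType K).
Implicit Types f g h : ginv B.

Fact gmul_coef0 f g : mmul f g 0 [tuple] == 0.
Proof. by rewrite mmul0E (eqP (ginv_coef0 f)) mul0r. Qed.

Definition gmul f g : ginv B := Ginv (gmul_coef0 f g).

Definition gidm : ginv B := @Ginv K B (idm B) (eqxx 0).

Lemma evm_gmul f g x : evm (gmul f g) x = dec (fun p q => evm f p * evm g q) x.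
Proof. exact: evm_mmul. Qed.

Lemma gmulA : associative gmul.
Proof.
move=> f g h; apply: ginv_ext => x; rewrite !evm_gmul.
transitivity (dec (fun p r => dec (fun q s =>
    evm f p * (evm g q * evm h s)) r) x).
  by apply: eq_dec => p r; rewrite evm_gmul dec_mulr.
rewrite dec_coassoc; apply: eq_dec => r s; rewrite evm_gmul dec_mull.
by apply: eq_dec => p q; rewrite mulrA.
Qed.

Lemma lamE f : lam f = gmul gidm f. Proof. exact/val_inj. Qed.

Lemma rhoE f : rho f = gmul f gidm. Proof. exact/val_inj. Qed.

(** A word of length other than 1 is killed by [I], so only the insertion of
    the whole word survives. *)
Lemma br_gidm g : br gidm g = g.
Proof.
apply: ginv_ext => x; rewrite evm_br dec_nill.
  by rewrite dec_nilr.
move=> a p r; rewrite dec0 // => q s.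
by case: p.
Qed.

(** The cut between the two factors of [f . h] falls either before or after
    the inserted value of [g]; coassociativity of the decomposition sums
    regroups each of the two families of terms. *)
Lemma br_gmul f h g : br (gmul f h) g = gmul (br f g) h + gmul f (br h g).
Proof.
apply: ginv_ext => x; rewrite evm_ginvD !evm_gmul evm_br.
transitivity (dec (fun p r => dec (fun q s =>
    dec (fun a b => evm f (p ++ evm g q :: a) * evm h b) s) r) x
  + dec (fun p r => dec (fun q s =>
    dec (fun a b => evm f a * evm h (b ++ evm g q :: s)) p) r) x).
  rewrite -decD; apply: eq_dec => p r; rewrite -decD; apply: eq_dec => q s.
  by rewrite evm_gmul dec_cat addrC.
congr (_ + _).
  transitivity (dec (fun p r => dec (fun u b => dec (fun q a =>
      evm f (p ++ evm g q :: a) * evm h b) u) r) x).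
    by apply: eq_dec => p r; rewrite dec_coassoc.
  rewrite dec_coassoc; apply: eq_dec => v b; rewrite evm_br dec_mull.
  by apply: eq_dec => p u; rewrite dec_mull.
transitivity (dec (fun p r => dec (fun a b => dec (fun q s =>
    evm f a * evm h (b ++ evm g q :: s)) r) p) x).
  by apply: eq_dec => p r; rewrite dec_exchange.
rewrite -(dec_coassoc (fun a b r => dec (fun q s =>
    evm f a * evm h (b ++ evm g q :: s)) r)).
apply: eq_dec => a w; rewrite evm_br dec_mulr.
by apply: eq_dec => b r; rewrite dec_mulr.
Qed.

Lemma br_lam f g : br (lam f) g = gmul g f + lam (br f g).
Proof. by rewrite !lamE br_gmul br_gidm. Qed.

Lemma br_rho f g : br (rho f) g = gmul f g + rho (br f g).
Proof. by rewrite !rhoE br_gmul br_gidm addrC. Qed.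

End InvertibleSeries.

Theorem proposition4p8 (K : fieldType) (K_char0 : [pchar K] =i pred0)
    (B : algType K) :
  nijenhuis (@lam K B) /\ nijenhuis (@rho K B).
Proof.
split=> f g.
  change (br (lam f) (lam g)
    = lam (br (lam f) g + br f (lam g) - lam (br f g))).
  rewrite !br_lam addrAC addrK linearD; congr (_ + _).
  by rewrite /= !lamE gmulA.
change (br (rho f) (rho g)
  = rho (br (rho f) g + br f (rho g) - rho (br f g))).
rewrite !br_rho addrAC addrK linearD; congr (_ + _).
by rewrite /= !rhoE gmulA.
Qed.
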